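(* Let $\|\cdot\|_1,\|\cdot\|_2,\|\cdot\|_3$ and $\|\cdot\|_4$ be norms on $\mathbb{C}^n$. Then $\|\cdot\|_{1,2}=\|\cdot\|_{3,4}$ on $M_n$ if and only if there exists $\gamma>0$ such that $\|\cdot\|_1=\gamma\|\cdot\|_3$ and $\|\cdot\|_2=\gamma\|\cdot\|_4$.
   Context: $M_n$ denotes the complex algebra of all $n\times n$ matrices over $\mathbb{C}$. Given norms $\|\cdot\|_i,\|\cdot\|_j$ on $\mathbb{C}^n$, the generalized induced norm $\|\cdot\|_{i,j}$ on $M_n$ is defined by $\|A\|_{i,j}=\max\{\|Ax\|_j:\|x\|_i=1\}$. *)

(* Defs.v *)
From HB Require Import structures.
From mathcomp Require Import all_boot all_order all_algebra.
From mathcomp Require Import boolp classical_sets reals.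
From mathcomp Require Import complex.
Set Implicit Arguments.
Unset Strict Implicit.
Unset Printing Implicit Defensive.
Import Order.TTheory GRing.Theory Num.Theory.
Local Open Scope classical_set_scope.
Local Open Scope ring_scope.
Local Open Scope complex_scope.

(* The modulus `|a| of a : R[i] is itself an element of R[i]; homogeneity is
   therefore stated after embedding the real values of N into R[i]. *)
Record is_norm (R : realType) (n : nat) (N : 'cV[R[i]]_n -> R) : Prop := IsNorm {
  norm_nonneg : forall x, 0 <= N x ;
  norm_definite : forall x, N x = 0 -> x = 0 ;
  norm_homogeneous :
    forall (a : R[i]) x, (N (a *: x))%:C = `|a| * (N x)%:C ;
  norm_triangle : forall x y, N (x + y) <= N x + N y }.

(* The greatest element of S; the value is 0 if S has no greatest element. *)
Definition maximum (R : realType) (S : set R) : R := xget 0 (S `&` ubound S).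

Lemma maximum_eq (R : realType) (S : set R) (m : R) :
  S m -> ubound S m -> maximum S = m.
Proof.
move=> Sm ubm; apply: xget_unique; first by split.
by move=> y [Sy uby]; apply/le_anti; rewrite (ubm _ Sy) (uby _ Sm).
Qed.

(* When 0 < n and N1, N2 are norms, the maximum exists: the unit sphere of N1
   is nonempty and compact, and x |-> N2 (A *m x) is continuous. When n = 0 the
   sphere is empty and the value is 0. *)
Definition induced_norm (R : realType) (n : nat)
    (N1 N2 : 'cV[R[i]]_n -> R) (A : 'M[R[i]]_n) : R :=
  maximum [set N2 (A *m x) | x in [set x | N1 x = 1]].

(* Main.v *)
From HB Require Import structures.
Require Import Defs.
From mathcomp Require Import all_boot all_order all_algebra.
From mathcomp Require Import boolp classical_sets reals.
From mathcomp Require Import complex ring lra.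
Import Order.TTheory GRing.Theory Num.Theory.
Local Open Scope ring_scope.
Local Open Scope complex_scope.

(** Only matrices of rank one are needed to recover the norms. Fix [x] and [y]
    nonzero. By the Hahn-Banach theorem there is a row [u] with
    [|u z| <= N1 z] for all [z] and equality at [z = x]. The matrix [y u] sends
    [z] to [(u z) y], so its norm from [N1] to [N2] is exactly [N2 y], and the
    maximum is visibly attained, at the normalization of [x]
    ([induced_norm_rank_one]). If the two induced norms agree, [N2 y] is also
    the norm of [y u] from [N3] to [N4]; bounding the image of [x] gives
    [N1 x * N4 y <= N2 y * N3 x] ([norm_cross_le]). Exchanging the two pairs of
    norms gives the reverse inequality, hence

      [N1 x * N4 y = N2 y * N3 x] for all [x] and [y],

    which says that [N1 / N3] and [N2 / N4] are one and the same constant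
    [gamma].

    Existence of the maximum is never an issue: on the side of [N1] and [N2] a
    maximizer is exhibited, and on the side of [N3] and [N4] the common value
    [N2 y] is nonzero, whereas [maximum] is [0] for a set without a greatest
    element ([induced_norm_bound]).

    The Hahn-Banach theorem is proved in its sublinear form: a minimal sublinear
    functional, obtained by Zorn's lemma, is linear ([minimal_sublinear],
    [hahn_banach_sublinear]). The complex form follows by taking for [f] the
    complex-linear functional with a given real part
    ([exists_norming_functional]). *)

(** * The Hahn-Banach theorem for sublinear functionals *)

Section Sublinear.
Context {R : realType} {V : lmodType R}.
Implicit Types (p q : V -> R) (x y v : V).

(** With the inequality for [t = 0] and subadditivity, [p 0 = 0], and the
    inequality for [t^-1] makes the second clause an equality for [0 < t];
    the one-sided form is what infima satisfy most directly. *)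
Definition sublinear p :=
  (forall x y, p (x + y) <= p x + p y) /\
  (forall t x, 0 <= t -> p (t *: x) <= t * p x).

Lemma sublinear0 p : sublinear p -> p 0 = 0.
Proof.
case=> pD pZ; have := pZ 0 0 (lexx 0); have := pD 0 0.
by rewrite scaler0 addr0; lra.
Qed.

Lemma sublinearZ p t x : sublinear p -> 0 <= t -> p (t *: x) = t * p x.
Proof.
move=> sp t0; apply/le_anti; rewrite sp.2 //=.
have [->|tn0] := eqVneq t 0; first by rewrite mul0r scale0r sublinear0.
have := sp.2 t^-1 (t *: x); rewrite invr_ge0 t0 scalerA mulVf // scale1r.
by move=> /(_ isT) h; rewrite mulrC -ler_pdivlMr ?lt0r ?tn0 // mulrC.
Qed.

Lemma sublinear_oppr_ge p x : sublinear p -> - p (- x) <= p x.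
Proof. by move=> sp; have := sp.1 x (- x); rewrite subrr sublinear0 //; lra. Qed.

(** An odd sublinear functional satisfies the two defining inequalities in both
    directions, so it is linear. *)
Lemma sublinear_odd_linear p :
  sublinear p -> (forall x, p (- x) <= - p x) -> scalar p.
Proof.
move=> sp podd; have pN x : p (- x) = - p x.
  apply/le_anti; rewrite podd /=; have := sublinear_oppr_ge p x sp; lra.
have pD x y : p (x + y) = p x + p y.
  apply/le_anti; rewrite sp.1 /=; have := sp.1 (- x) (- y).
  by rewrite -opprD !pN; lra.
move=> t x y; rewrite pD; congr (_ + _).
have [t0|t0] := leP 0 t; first exact: sublinearZ.
by rewrite -[t]opprK scaleNr pN sublinearZ ?oppr_ge0 ?ltW // !mulNr.
Qed.

(** For sublinear [p], the largest sublinear functional below [p] whose value at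
    [- v] is at most [- p v]: any such [q] satisfies
    [q x <= q (x + t v) + q (- t v) <= p (x + t v) - t p v] for [0 <= t]. A
    minimal sublinear functional equals all its straightenings, so it is odd. *)
Definition straighten p v x : R :=
  inf [set p (x + t *: v) - t * p v | t in [set t : R | 0 <= t]]%classic.

Lemma straighten_has_inf p v x : sublinear p ->
  has_inf [set p (x + t *: v) - t * p v | t in [set t : R | 0 <= t]]%classic.
Proof.
move=> sp; split; first by exists (p (x + 0 *: v) - 0 * p v), 0 => /=.
exists (- p (- x)) => _ [t /= t0 <-].
rewrite -(sublinearZ p t v) //.
have := sp.1 (x + t *: v) (- x).
by rewrite [x + _]addrC addrK [_ + x]addrC; lra.
Qed.

Lemma straighten_le_at p v x t : sublinear p -> 0 <= t ->
  straighten p v x <= p (x + t *: v) - t * p v.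
Proof.
move=> sp t0; apply: ge_inf; last by exists t.
by case: (straighten_has_inf p v x sp).
Qed.

Lemma straighten_ge p v x c : sublinear p ->
  (forall t, 0 <= t -> c <= p (x + t *: v) - t * p v) ->
  c <= straighten p v x.
Proof.
move=> sp h; apply: lb_le_inf; first by case: (straighten_has_inf p v x sp).
by move=> _ [t /= t0 <-]; exact: h.
Qed.

Lemma straighten_le p v x : sublinear p -> straighten p v x <= p x.
Proof.
move=> sp; have := straighten_le_at p v x 0 sp (lexx 0).
by rewrite scale0r addr0 mul0r subr0.
Qed.

Lemma straighten_opp p v : sublinear p -> straighten p v (- v) <= - p v.
Proof.
move=> sp; have := straighten_le_at p v (- v) 1 sp ler01.
by rewrite scale1r addNr sublinear0 // mul1r sub0r.
Qed.

Lemma straighten_sublinear p v : sublinear p -> sublinear (straighten p v).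
Proof.
move=> sp; split=> [x y|s x s0].
  rewrite -lerBlDr; apply: straighten_ge => // t t0.
  rewrite lerBlDl -lerBlDr; apply: straighten_ge => // u u0.
  have := straighten_le_at p v (x + y) (t + u) sp (addr_ge0 t0 u0).
  rewrite scalerDl addrACA; have := sp.1 (x + t *: v) (y + u *: v).
  by lra.
have [->|sn0] := eqVneq s 0.
  by rewrite scale0r mul0r (le_trans (straighten_le _ _ _ sp)) ?sublinear0.
have sgt0 : 0 < s by rewrite lt_neqAle eq_sym sn0.
rewrite mulrC -ler_pdivrMr //; apply: straighten_ge => // t t0.
rewrite ler_pdivrMr //.
have := straighten_le_at p v (s *: x) (s * t) sp (mulr_ge0 s0 t0).
by rewrite -scalerA -scalerDr; have := sp.2 s (x + t *: v) s0; lra.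
Qed.

(** Directedness serves subadditivity: to compare with [F i x + F j y], take an
    index whose functional is below both [F i] and [F j]. *)
Lemma directed_inf_sublinear {I : Type} {F : I -> V -> R} {D : set I} :
  (exists i, D i) -> (forall i, D i -> sublinear (F i)) ->
  (forall x, has_lbound [set F i x | i in D]%classic) ->
  (forall i j, D i -> D j -> exists k,
     [/\ D k, forall x, F k x <= F i x & forall x, F k x <= F j x]) ->
  sublinear (fun x => inf [set F i x | i in D]%classic).
Proof.
move=> [i0 Di0] Fsub Flb Fdir; set f := fun x => _.
have f_le i x : D i -> f x <= F i x.
  by move=> Di; apply: ge_inf; [exact: Flb | exists i].
have f_ge x c : (forall i, D i -> c <= F i x) -> c <= f x.
  move=> h; apply: lb_le_inf; first by exists (F i0 x), i0.
  by move=> _ [i Di <-]; exact: h.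
split=> [x y|t x t0].
  rewrite -lerBlDr; apply: (f_ge) => i Di.
  rewrite lerBlDl -lerBlDr; apply: (f_ge) => j Dj.
  have [k [Dk ki kj]] := Fdir i j Di Dj.
  have := f_le k (x + y) Dk; have := (Fsub k Dk).1 x y.
  by have := ki x; have := kj y; lra.
have [->|tn0] := eqVneq t 0.
  by rewrite scale0r mul0r (le_trans (f_le i0 0 Di0)) ?sublinear0 //; exact: Fsub.
have tgt0 : 0 < t by rewrite lt0r tn0.
rewrite mulrC -ler_pdivrMr //; apply: (f_ge) => i Di; rewrite ler_pdivrMr // mulrC.
exact: le_trans (f_le i _ Di) ((Fsub i Di).2 t x t0).
Qed.

(** Zorn's lemma applies because the pointwise infimum of a chain of sublinear
    functionals below [p] is sublinear, the values at [x] being bounded below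
    by [- p (- x)]. *)
Lemma minimal_sublinear p : sublinear p ->
  exists q, [/\ sublinear q, forall x, q x <= p x &
    forall q', sublinear q' -> (forall x, q' x <= q x) -> q' = q].
Proof.
move=> sp; pose T := {q : V -> R | sublinear q /\ forall x, q x <= p x}.
pose above (q1 q2 : T) := `[< forall x, sval q2 x <= sval q1 x >].
have svalI (q1 q2 : T) : sval q1 = sval q2 -> q1 = q2.
  by case: q1 q2 => [? ?] [? ?] /= h; apply: eq_exist.
have [] := @Zorn T above.
- by move=> q; apply/asboolP.
- move=> q1 q2 q3 /asboolP h12 /asboolP h23; apply/asboolP => x.
  exact: le_trans (h23 x) (h12 x).
- move=> q1 q2 /asboolP h12 /asboolP h21; apply/svalI/funext => x.
  by apply/le_anti; rewrite h12 h21.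
- move=> A Atot.
  have [[q0 Aq0]|A0] := pselect (exists q : T, A q); last first.
    by exists (exist _ p (conj sp (fun x => lexx (p x)))) => q Aq; case: A0; exists q.
  have Alb x : has_lbound [set sval q x | q in A]%classic.
    exists (- p (- x)) => _ [[q [sq qp]] _ <-] /=.
    by have := sublinear_oppr_ge q x sq; have := qp (- x); lra.
  pose r x := inf [set sval q x | q in A]%classic.
  have r_le (q : T) x : A q -> r x <= sval q x.
    by move=> Aq; apply: ge_inf; [exact: Alb | exists q].
  have sr : sublinear r.
    apply: directed_inf_sublinear => //; first by exists q0.
      by move=> q _; case: (svalP q).
    move=> q1 q2 A1 A2; case: (Atot q1 q2 A1 A2) => /asboolP h.
      by exists q2; split.
    by exists q1; split.
  have rp x : r x <= p x by apply: le_trans (r_le q0 x Aq0) ((svalP q0).2 x).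
  by exists (exist _ r (conj sr rp)) => q Aq; apply/asboolP => x; exact: r_le.
- move=> [q [sq qp]] qmin; exists q; split=> // q' sq' q'q.
  have h : sublinear q' /\ forall x, q' x <= p x.
    by split=> // x; exact: le_trans (q'q x) (qp x).
  by have /(congr1 sval) := qmin (exist _ q' h) (asboolT q'q).
Qed.

(** The minimal functional is sought below [straighten p v] rather than below
    [p]: its value at [- v] is then at most [- p v], and being odd it takes the
    full value [p v] at [v]. *)
Theorem hahn_banach_sublinear p v : sublinear p ->
  exists f : {scalar V}, (forall x, f x <= p x) /\ f v = p v.
Proof.
move=> sp.
have [q [sq qle qmin]] := minimal_sublinear _ (straighten_sublinear p v sp).
have qp x : q x <= p x by exact: le_trans (qle x) (straighten_le p v x sp).
have qlin : scalar q.
  apply: sublinear_odd_linear => // w.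
  rewrite -{1}(qmin (straighten q w)); first exact: straighten_opp.
    exact: straighten_sublinear.
  by move=> x; exact: straighten_le.
pose F := GRing.isLinear.Build R V R^o *%R q qlin.
pose f : {scalar V} := HB.pack q F.
exists f; split=> //; apply/le_anti; rewrite qp /=.
have := qle (- v); have := straighten_opp p v sp.
have -> : q (- v) = - q v by exact: (raddfN f).
by rewrite /=; lra.
Qed.

End Sublinear.

(** * Restriction of scalars and norming functionals *)

(** A copy of [W], so that real and complex scalings do not compete on one
    carrier. *)
Definition realify {R : realType} (W : lmodType R[i]) : Type := W.

Section Realify.
Context {R : realType} {W : lmodType R[i]}.

HB.instance Definition _ := GRing.Zmodule.on (realify W).

Definition realify_scale (t : R) (x : realify W) : realify W :=
  t%:C *: (x : W).

Lemma realify_scaleA a b v :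
  realify_scale a (realify_scale b v) = realify_scale (a * b) v.
Proof. by rewrite /realify_scale scalerA -rmorphM. Qed.

Lemma realify_scale1 : left_id 1 realify_scale.
Proof. by move=> x; rewrite /realify_scale rmorph1 scale1r. Qed.

Lemma realify_scaleDr : right_distributive realify_scale +%R.
Proof. by move=> a x y; exact: scalerDr. Qed.

Lemma realify_scaleDl v : {morph realify_scale^~ v : a b / a + b}.
Proof. by move=> a b; rewrite /realify_scale rmorphD scalerDl. Qed.

HB.instance Definition _ := GRing.Zmodule_isLmodule.Build R (realify W)
  realify_scaleA realify_scale1 realify_scaleDr realify_scaleDl.

(** A real-linear [g] is the real part of the complex-linear
    [x |-> g x - i g (i x)]. *)
Lemma complexify_linear (g : {scalar realify W}) :
  linear_for *%R (fun x : W => g x +i* (- g ('i *: x))).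
Proof.
have gZ (t : R) (x : W) : g (t%:C *: x) = t * g x by exact: (scalarZ g t x).
have gD (x y : W) : g (x + y) = g x + g y by exact: (raddfD g x y).
have gN (x : W) : g (- x) = - g x by exact: (raddfN g x).
move=> [a b] x y.
have E (c d : R) (z : W) : g ((c +i* d) *: z) = c * g z + d * g ('i *: z).
  have -> : c +i* d = c%:C + d%:C * 'i.
    by apply/eqP; rewrite eq_complex /=; apply/andP; split; apply/eqP; ring.
  by rewrite scalerDl -scalerA gD !gZ.
have iE : 'i * (a +i* b) = (- b) +i* a :> R[i].
  by apply/eqP; rewrite eq_complex /=; apply/andP; split; apply/eqP; ring.
rewrite scalerDr scalerA iE !gD (E a b) (E (- b) a).
by apply/eqP; rewrite eq_complex /=; apply/andP; split; apply/eqP; ring.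
Qed.

(** Multiplying [x] by the unit scalar that makes [f x] real and nonnegative
    turns a bound on the real part of [f] into a bound on its modulus. *)
Lemma norm_le_of_Re_le (f : W -> R[i]) (N : W -> R) :
  (forall a x, f (a *: x) = a * f x) ->
  (forall a x, (N (a *: x))%:C = `|a| * (N x)%:C) ->
  (forall x, complex.Re (f x) <= N x) -> forall x, `|f x| <= (N x)%:C.
Proof.
move=> fZ NZ fN x.
have [f0|fx0] := eqVneq (f x) 0.
  by have := fN x; rewrite f0 normr0 lecR.
pose a := `|f x| / f x.
have a1 : `|a| = 1 by rewrite normrM normfV normr_id divff ?normr_eq0.
have NE : N (a *: x) = N x by apply: complexI; rewrite NZ a1 mul1r.
rewrite -NE; have := fN (a *: x); rewrite fZ /a divfK //.
by rewrite normc_def /= lecR.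
Qed.

(** A seminorm is sublinear over the reals; at [x0] the real part of [f] already
    equals [N x0], so the bound on the modulus is an equality there. *)
Theorem exists_norming_functional (N : W -> R) (x0 : W) :
  (forall a x, (N (a *: x))%:C = `|a| * (N x)%:C) ->
  (forall x y, N (x + y) <= N x + N y) ->
  exists f : {scalar W},
    (forall x, `|f x| <= (N x)%:C) /\ `|f x0| = (N x0)%:C.
Proof.
move=> NZ ND.
have sN : sublinear (N : realify W -> R).
  split=> // t x t0; suff -> : N (t *: x) = t * N x by [].
  by apply: complexI; rewrite NZ rmorphM /= ger0_norm // ler0c.
have [g [gN gx0]] := hahn_banach_sublinear _ (x0 : realify W) sN.
pose F := GRing.isLinear.Build R[i] W R[i]^o *%R _ (complexify_linear g).
pose f : {scalar W} := HB.pack (fun x : W => g x +i* (- g ('i *: x))) F.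
have fZ a x : f (a *: x) = a * f x by exact: (scalarZ f a x).
have fN := norm_le_of_Re_le f N fZ NZ gN.
exists f; split=> //; apply/le_anti; rewrite fN /= -gx0.
rewrite (le_trans _ (normc_ge_Re _)) // lecR /=; exact: ler_norm.
Qed.

End Realify.

(** * Induced norms of rank-one matrices *)

Section Induced.
Context {R : realType} {n : nat}.
Implicit Types (N : 'cV[R[i]]_n -> R) (x y : 'cV[R[i]]_n) (u : 'rV[R[i]]_n).

Lemma normZ_real N (t : R) x : is_norm N -> 0 <= t -> N (t%:C *: x) = t * N x.
Proof.
move=> hN t0; apply: complexI.
by rewrite norm_homogeneous // rmorphM /= ger0_norm // ler0c.
Qed.

Lemma norm0 N : is_norm N -> N 0 = 0.
Proof. by move=> hN; have := normZ_real N 0 0 hN (lexx 0); rewrite scaler0 mul0r. Qed.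

Lemma norm_gt0 N x : is_norm N -> x != 0 -> 0 < N x.
Proof.
move=> hN x0; rewrite lt0r norm_nonneg // andbT; apply/eqP => Nx.
by move/eqP: x0; apply; exact: norm_definite Nx.
Qed.

Lemma norm_normalize N x : is_norm N -> x != 0 -> N ((N x)^-1%:C *: x) = 1.
Proof.
move=> hN x0; have Nx := norm_gt0 N x hN x0.
by rewrite normZ_real ?invr_ge0 ?ltW // mulVf // gt_eqF.
Qed.

Lemma exists_norming_row N x0 : is_norm N ->
  exists u, (forall x, `|(u *m x) 0 0| <= (N x)%:C) /\
            `|(u *m x0) 0 0| = (N x0)%:C.
Proof.
move=> [_ _ NZ ND]; have [f [fN fx0]] := exists_norming_functional N x0 NZ ND.
exists (\row_j f (delta_mx j 0)).
suff E x : ((\row_j f (delta_mx j 0)) *m x) 0 0 = f x.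
  by split=> [x|]; rewrite E.
rewrite {2}[x]matrix_sum_delta mxE linear_sum; apply: eq_bigr => j _.
by rewrite big_ord1 mxE linearZ /= mulrC.
Qed.

Lemma norm_rank_one N y u x : is_norm N ->
  (N (y *m u *m x))%:C = `|(u *m x) 0 0| * (N y)%:C.
Proof.
move=> hN; rewrite -mulmxA [u *m x]mx11_scalar mul_mx_scalar.
by rewrite norm_homogeneous // -mx11_scalar.
Qed.

(** The bound on [u] makes [N2 y] an upper bound, and the normalization of [x0],
    where [u] has modulus [1], attains it. *)
Lemma induced_norm_rank_one N1 N2 y u x0 : is_norm N1 -> is_norm N2 ->
  x0 != 0 -> (forall x, `|(u *m x) 0 0| <= (N1 x)%:C) ->
  `|(u *m x0) 0 0| = (N1 x0)%:C -> induced_norm N1 N2 (y *m u) = N2 y.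
Proof.
move=> h1 h2 x0n0 uN ux0; apply: maximum_eq.
  exists ((N1 x0)^-1%:C *: x0) => /=; first exact: norm_normalize.
  apply: complexI; rewrite norm_rank_one // -scalemxAr mxE normrM ux0.
  have Nx0 := norm_gt0 N1 x0 h1 x0n0.
  rewrite ger0_norm ?ler0c ?invr_ge0 ?ltW // -rmorphM /= mulVf ?gt_eqF //.
  by rewrite mul1r.
move=> _ [x /= Nx <-]; rewrite -lecR norm_rank_one //.
by rewrite ler_piMl ?ler0c ?norm_nonneg // (le_trans (uN x)) // Nx.
Qed.

(** A nonzero value of [induced_norm] is not the default of [maximum], so it is
    an upper bound on the unit sphere. *)
Lemma induced_norm_bound N1 N2 A x : is_norm N1 -> is_norm N2 ->
  induced_norm N1 N2 A != 0 -> N2 (A *m x) <= induced_norm N1 N2 A * N1 x.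
Proof.
move=> h1 h2; rewrite /induced_norm /maximum.
case: xgetP => [m _ [_ ubm] _|_]; last by rewrite eqxx.
have [->|x0] := eqVneq x 0; first by rewrite mulmx0 !norm0 // mulr0.
have Nx := norm_gt0 N1 x h1 x0.
have Nx_inv : 0 <= (N1 x)^-1 by rewrite invr_ge0 ltW.
rewrite -ler_pdivrMr // mulrC -(normZ_real N2) // scalemxAr.
by apply: ubm; exists ((N1 x)^-1%:C *: x) => //; exact: norm_normalize.
Qed.

(** For [u] norming at [x] for [N1], the matrix [y u] has first induced norm
    [N2 y] and sends [x] to a vector of [N4]-norm [N1 x * N4 y]. *)
Lemma norm_cross_le N1 N2 N3 N4 x y :
  is_norm N1 -> is_norm N2 -> is_norm N3 -> is_norm N4 ->
  (forall A, induced_norm N1 N2 A = induced_norm N3 N4 A) ->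
  N1 x * N4 y <= N2 y * N3 x.
Proof.
move=> h1 h2 h3 h4 H.
have [->|x0] := eqVneq x 0; first by rewrite !norm0 // mul0r mulr0.
have [->|y0] := eqVneq y 0; first by rewrite !norm0 // mul0r mulr0.
have [u [uN ux]] := exists_norming_row N1 x h1.
have E := induced_norm_rank_one N1 N2 y u x h1 h2 x0 uN ux.
have := induced_norm_bound N3 N4 (y *m u) x h3 h4.
rewrite -H E gt_eqF ?norm_gt0 // => /(_ isT).
by rewrite -lecR norm_rank_one // ux -rmorphM lecR.
Qed.

(** Scaling by [gamma] maps the unit sphere of [gamma * N3] onto that of [N3],
    and [gamma * N4 (A x) = N4 (A (gamma x))]. *)
Lemma induced_norm_scale N1 N2 N3 N4 (gamma : R) A :
  is_norm N3 -> is_norm N4 -> 0 < gamma ->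
  (forall x, N1 x = gamma * N3 x) -> (forall x, N2 x = gamma * N4 x) ->
  induced_norm N1 N2 A = induced_norm N3 N4 A.
Proof.
move=> h3 h4 g0 E1 E2; congr maximum; apply/seteqP; split=> _ [x /= Nx <-].
  exists (gamma%:C *: x) => /=; first by rewrite normZ_real ?ltW // -E1.
  by rewrite -scalemxAr normZ_real ?ltW // -E2.
exists (gamma^-1%:C *: x) => /=.
  by rewrite E1 normZ_real ?invr_ge0 ?ltW // mulVKf ?gt_eqF.
by rewrite E2 -scalemxAr normZ_real ?invr_ge0 ?ltW // mulVKf ?gt_eqF.
Qed.

End Induced.

(** * Equality of induced norms *)

Theorem corollary2p5 (R : realType) (n : nat)
    (N1 N2 N3 N4 : 'cV[R[i]]_n -> R)
    (hN1 : is_norm N1) (hN2 : is_norm N2)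
    (hN3 : is_norm N3) (hN4 : is_norm N4) :
  (forall A : 'M[R[i]]_n, induced_norm N1 N2 A = induced_norm N3 N4 A) <->
  (exists gamma : R,
     [/\ 0 < gamma,
         (forall x, N1 x = gamma * N3 x) &
         (forall x, N2 x = gamma * N4 x)]).
Proof.
split=> [H|[gamma [g0 E1 E2]] A]; last exact: induced_norm_scale E1 E2.
have cross x y : N1 x * N4 y = N2 y * N3 x.
  apply/le_anti; rewrite norm_cross_le //= mulrC [N1 x * _]mulrC.
  by apply: norm_cross_le => // A; rewrite H.
have [[z z0]|V0] := pselect (exists z : 'cV[R[i]]_n, z != 0); last first.
  (* When [n = 0] all four functions vanish, and any constant will do. *)
  have all0 x : x = 0 :> 'cV[R[i]]_n.
    by apply/eqP/negPn/negP => x0; apply: V0; exists x.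
  by exists 1; split=> // x; rewrite (all0 x) !norm0 // mulr0.
have N3z := norm_gt0 N3 z hN3 z0; have N4z := norm_gt0 N4 z hN4 z0.
have E2 y : N2 y = N1 z / N3 z * N4 y.
  by rewrite mulrAC cross mulfK ?gt_eqF.
exists (N1 z / N3 z); split=> // [|x]; first by rewrite divr_gt0 // norm_gt0.
apply: (mulIf (x := N4 z)); first by rewrite gt_eqF.
by rewrite cross E2 mulrAC.
Qed.
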